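(* Let $H=\alpha(x)(R-I)+\beta(x)(TR-I)$ be the Bannai-Ito operator with real parameters $\rho_1,\rho_2,r_1,r_2$, let $\phi(x)$ be an eigenfunction of $H$ (the seed solution) with $H[\phi(x)]=\mu\phi(x)$ and with $\chi,\tilde\chi$ (defined in the context) not identically zero, and let $H^{(1)}$ be the associated 1-step exceptional Bannai-Ito operator. Let $$\mathcal F_\phi=\frac1{\chi(x)}(R-I)+\frac1{\tilde\chi(x)}(TR+I)\beta(-x-1),$$ $$\mathcal B_\phi=\alpha(x)(R-I)\tilde\chi(x)+(TR+I)\alpha(x)\beta(-x-1)\chi(x).$$ Then $\mathcal F_\phi[\phi(x)]=0$, and the intertwining relations $$\mathcal F_\phi\circ H=H^{(1)}\circ\mathcal F_\phi,\qquad H\circ\mathcal B_\phi=\mathcal B_\phi\circ H^{(1)}$$ hold. Moreover, with the constant $\beta:=r_1+r_2$, $$\mathcal B_\phi\circ\mathcal F_\phi=(H-\mu)\circ(H-\beta),\qquad \mathcal F_\phi\circ\mathcal B_\phi=(H^{(1)}-\mu)\circ(H^{(1)}-\beta).$$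
   Context: The operators act on functions of $x$ by $R[f(x)]=f(-x)$, $T[f(x)]=f(x+1)$, $I[f(x)]=f(x)$, so $TR[f(x)]=f(-x-1)$. A function standing to the left or right of an operator denotes multiplication by that function; products are compositions. Functions are taken in a field of functions of $x$ containing the rational functions and closed under $x\mapsto -x$, $x\mapsto x+1$ (for example meromorphic functions). Bannai-Ito operator: $H=\alpha(x)(R-I)+\beta(x)(TR-I)$ with $$\alpha(x)=\frac{(x-\rho_1)(x-\rho_2)}{-2x},\qquad \beta(x)=\frac{(x-r_1+1/2)(x-r_2+1/2)}{2x+1}.$$ For these, $\alpha(x)+\alpha(-x)=\rho_1+\rho_2=:\alpha$ and $\beta(x)+\beta(-x-1)=-(r_1+r_2)=:-\beta$ are constants (the symbols $\alpha,\beta$ without argument denote these constants). For the seed solution $\phi$: $\chi(x)=\phi(x)-\phi(-x)$ and $\tilde\chi(x)=\beta(-x-1)\phi(x)+\beta(x)\phi(-x-1)$. 1-step exceptional Bannai-Ito operator: $$H^{(1)}=\frac{\tilde\chi(-x)}{\chi(x)}(R-I)+\frac{\alpha(-x-1)\beta(x)\chi(-x-1)}{\tilde\chi(x)}(TR-I)-(\mu+\alpha-\beta).$$ *)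

(* Defs.v *)
From mathcomp Require Import all_boot all_order all_algebra.
From mathcomp Require Import all_classical all_reals all_analysis.

Set Implicit Arguments.
Unset Strict Implicit.
Unset Printing Implicit Defensive.

Import Order.TTheory GRing.Theory Num.Theory.

Local Open Scope classical_set_scope.
Local Open Scope ring_scope.

(* A field of functions of one variable over F (real functions for F a realType,
   complex ones for F = R[i]), containing the rational functions and closed
   under x |-> - x and x |-> x + 1.  Its elements are represented by total
   functions F -> F.  Elements such as meromorphic functions are only defined
   outside a small exceptional set, so two representatives are identified when
   they agree at every x of some set in the filter [generic] (for meromorphic
   functions: the sets whose complement is contained in a closed discrete set);
   the values at poles are irrelevant. *)
Record functionField (F : numFieldType) := FunctionField {
  generic : set_system F;
  generic_proper : ProperFilter generic;
  generic_neq : forall a : F, \forall x \near generic, x != a;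
  generic_opp : forall A : set F, generic A -> generic [set x | A (- x)];
  generic_add1 : forall A : set F, generic A -> generic [set x | A (x + 1)];
  member : set (F -> F);
  member_near : forall f g : F -> F,
    member f -> (\forall x \near generic, f x = g x) -> member g;
  member_rat : forall p q : {poly F},
    q != 0 -> member (fun x => p.[x] / q.[x]);
  memberD : forall f g : F -> F,
    member f -> member g -> member (fun x => f x + g x);
  memberN : forall f : F -> F, member f -> member (fun x => - f x);
  memberM : forall f g : F -> F,
    member f -> member g -> member (fun x => f x * g x);
  member_inv : forall f : F -> F,
    member f -> ~ (\forall x \near generic, f x = 0) ->
    exists2 g : F -> F, member g & \forall x \near generic, f x * g x = 1;
  member_opp : forall f : F -> F, member f -> member (fun x => f (- x));
  member_add1 : forall f : F -> F, member f -> member (fun x => f (x + 1))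
}.

Definition eq_elt (F : numFieldType) (K : functionField F) (f g : F -> F) :
  Prop := \forall x \near generic K, f x = g x.

Definition eq_oper (F : numFieldType) (K : functionField F)
  (A B : (F -> F) -> (F -> F)) : Prop :=
  forall f : F -> F, member K f -> eq_elt K (A f) (B f).

Notation "f =[ K ] g" := (eq_elt K f g)
  (at level 70, K at level 0, no associativity) : ring_scope.
Notation "A =op[ K ] B" := (eq_oper K A B)
  (at level 70, K at level 0, no associativity) : ring_scope.

(* Sums and differences of operators are the pointwise ones; products are
   compositions, written with \o. *)
Section Operators.
Variable F : numFieldType.

Definition opR (f : F -> F) : F -> F := fun x => f (- x).
Definition opT (f : F -> F) : F -> F := fun x => f (x + 1).
Definition opI (f : F -> F) : F -> F := f.
Definition opM (a f : F -> F) : F -> F := fun x => a x * f x.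
Definition opC (c : F) : (F -> F) -> (F -> F) := opM (fun=> c).

End Operators.

Arguments opR {F}.
Arguments opT {F}.
Arguments opI {F}.

Section BannaiIto.
Variables (F : numFieldType) (rho1 rho2 r1 r2 : F).

Definition alpha (x : F) : F := (x - rho1) * (x - rho2) / (- 2 * x).
Definition beta (x : F) : F :=
  (x - r1 + 1 / 2) * (x - r2 + 1 / 2) / (2 * x + 1).

(* The constant values of alpha x + alpha (- x) and - (beta x + beta (- x - 1)). *)
Definition alpha_cst : F := rho1 + rho2.
Definition beta_cst : F := r1 + r2.

Definition opH : (F -> F) -> (F -> F) :=
  (opM alpha \o (opR - opI)) + (opM beta \o ((opT \o opR) - opI)).

Variables (mu : F) (phi : F -> F).

Definition chi (x : F) : F := phi x - phi (- x).
Definition chit (x : F) : F :=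
  beta (- x - 1) * phi x + beta x * phi (- x - 1).

Definition opH1 : (F -> F) -> (F -> F) :=
  (opM (fun x => chit (- x) / chi x) \o (opR - opI))
  + (opM (fun x => alpha (- x - 1) * beta x * chi (- x - 1) / chit x)
       \o ((opT \o opR) - opI))
  - opC (mu + alpha_cst - beta_cst).

Definition opF : (F -> F) -> (F -> F) :=
  (opM (fun x => 1 / chi x) \o (opR - opI))
  + (opM (fun x => 1 / chit x) \o ((opT \o opR) + opI)
       \o opM (fun x => beta (- x - 1))).

Definition opB : (F -> F) -> (F -> F) :=
  (opM alpha \o (opR - opI) \o opM chit)
  + (((opT \o opR) + opI)
       \o opM (fun x => alpha x * beta (- x - 1) * chi x)).

End BannaiIto.

(* Main.v *)
Require Import Defs.
From mathcomp Require Import all_boot all_order all_algebra.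
From mathcomp Require Import all_classical all_reals all_analysis.
From mathcomp Require Import ring.

Set Implicit Arguments.
Unset Strict Implicit.
Unset Printing Implicit Defensive.

Import Order.TTheory GRing.Theory Num.Theory.

Local Open Scope ring_scope.

(** The four operators share one matrix factorization.  Put [D = R - I]
    ([dif] below), [S = (TR + I) beta(-x-1)] ([sym]), [a = alpha(x)]
    and [b = r1 + r2].  Then
    [H - b = a D + S], [F = chi^-1 D + chit^-1 S], [B = a D chit + S a chi]
    and [H1 - mu = chi^-1 D chit + chit^-1 S a chi].  In terms of the rows
    [L0 = (a, 1)], [L1 = (chi^-1, chit^-1)] and of the columns [C0 = (D ; S)],
    [C1 = (D chit ; S a chi)] this reads
<<
      H - b = L0 C0,   F = L1 C0,   B = L0 C1,   H1 - mu = L1 C1.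
>>
    By the eigenvalue equation [H phi = mu phi], the seed satisfies
    [chit = a chi + (mu - b) phi] (lemma [chit_seed]).  Comparing this at [x]
    and [-x], and at [x] and [-x-1], eliminates [phi] and leaves
    [D chit = - (alpha(x) + alpha(-x) + mu - b) chi] and [S (a chi) = - mu chit]
    (lemmas [chit_sub_opp] and [sym_achi]).  These two identities put [H1] in
    the form above.  They also give [C1 L1 = C0 L0 - (mu - b)] on pairs [(u, v)]
    with [u] odd under [R] and [v] invariant under [TR] (lemmas
    [dif_chit_rowF] and [sym_achi_rowF]): then [u / chi] is invariant under [R]
    and [v / chit] under [TR], so they can be pulled out of [D] and [S].  The
    images of [C0] and [C1] consist of such pairs, hence
<<
      C1 F = C0 (H - mu),   C1 (H1 - b) = C0 B.
>>
    Applying [L0] and [L1] to these two equalities gives the two intertwining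
    relations and the two factorizations.

    All equalities are between elements of the function field, that is, they
    hold on a generic set of points.  The filter of generic sets is stable under
    [x |-> -x] and [x |-> -x-1], so [D] and [S] respect such equalities. *)

(** * Generic points *)

Section NearGeneric.
Variables (F : numFieldType) (K : functionField F).

#[local] Instance generic_filter : ProperFilter (generic K) :=
  generic_proper K.

Lemma near_opp (P : F -> Prop) :
  (\forall x \near generic K, P x) -> \forall x \near generic K, P (- x).
Proof. by move=> /(generic_opp (f0 := K)). Qed.

Lemma near_refl1 (P : F -> Prop) :
  (\forall x \near generic K, P x) -> \forall x \near generic K, P (- x - 1).
Proof.
move=> /near_opp /(generic_add1 (f0 := K)); apply: filterS => x /=.
by rewrite opprD.
Qed.

Lemma near_neq0 (f : F -> F) : member K f -> ~ (f =[K] (fun=> 0)) ->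
  \forall x \near generic K, f x != 0.
Proof.
move=> fK /(member_inv fK)[g _]; apply: filterS => x fg1.
apply/eqP => f0; move/eqP: fg1.
by rewrite f0 mul0r eq_sym oner_eq0.
Qed.

Lemma near_denom_neq0 : \forall x \near generic K, 2 * x + 1 != 0.
Proof.
apply: filterS (generic_neq K (- 1 / 2)) => x; apply: contraNN => /eqP x0.
have -> : - 1 / 2 = x - (2 * x + 1) / 2 :> F by field.
by rewrite x0 mul0r subr0.
Qed.

Lemma member_polyquot (p q : {poly F}) (f : F -> F) :
  q != 0 -> (forall x, f x = p.[x] / q.[x]) -> member K f.
Proof.
by move=> q0 fE; have := @member_rat F K p q q0; congr member; apply/funext.
Qed.

End NearGeneric.

#[local] Existing Instance generic_filter.

(** * The operators as products of rows and columns *)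

Section Operators.
Variables (F : numFieldType) (K : functionField F) (rho1 rho2 r1 r2 : F).
Local Notation a := (alpha rho1 rho2).
Local Notation be := (beta r1 r2).
Local Notation b := (beta_cst r1 r2).
Local Notation H := (opH rho1 rho2 r1 r2).

Definition dif (f : F -> F) (x : F) : F := f (- x) - f x.
Definition sym (f : F -> F) (x : F) : F :=
  be (- x - 1) * f x + be x * f (- x - 1).

Lemma refl1K (x : F) : - (- x - 1) - 1 = x. Proof. by ring. Qed.

Lemma dif_odd f x : dif f (- x) = - dif f x.
Proof. by rewrite /dif opprK opprB. Qed.

Lemma sym_refl1 f x : sym f (- x - 1) = sym f x.
Proof. by rewrite /sym refl1K addrC. Qed.

Lemma dif_ext f g : f =[K] g -> dif f =[K] dif g.
Proof.
by move=> fg; apply: filterS2 fg (near_opp fg) => x; rewrite /dif => -> ->.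
Qed.

Lemma sym_ext f g : f =[K] g -> sym f =[K] sym g.
Proof.
by move=> fg; apply: filterS2 fg (near_refl1 fg) => x; rewrite /sym => -> ->.
Qed.

Lemma difDZ f g c x : dif (fun y => f y + c * g y) x = dif f x + c * dif g x.
Proof. by rewrite /dif; ring. Qed.

Lemma symDZ f g c x : sym (fun y => f y + c * g y) x = sym f x + c * sym g x.
Proof. by rewrite /sym; ring. Qed.

Lemma beta_member : member K be.
Proof.
apply: (@member_polyquot F K (('X - (r1 - 1 / 2)%:P) * ('X - (r2 - 1 / 2)%:P))
  (2 *: 'X + 1)).
  apply/eqP => /(congr1 (fun p : {poly F} => p.[0])).
  by rewrite !hornerE => /eqP; rewrite oner_eq0.
by move=> x; rewrite /beta !hornerE; congr (_ / _); ring.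
Qed.

Lemma beta_add_refl1 x : 2 * x + 1 != 0 -> be x + be (- x - 1) = - b.
Proof.
move=> x0; rewrite /beta /beta_cst.
have x1 : 2 * (- x - 1) + 1 != 0.
  by rewrite (_ : _ + 1 = - (2 * x + 1)) ?oppr_eq0 //; ring.
by field; rewrite x0 x1.
Qed.

(** [H - b = a D + S]: the multiplication part [- beta(x)] of [H] becomes
    [beta(-x-1) + b]. *)
Lemma opH_dif_sym f : H f =[K] (fun x => a x * dif f x + sym f x + b * f x).
Proof.
apply: filterS (near_denom_neq0 K) => x /beta_add_refl1 bE.
have -> : b = - (be x + be (- x - 1)) by rewrite bE opprK.
by rewrite /opH /opM /opT /opR /opI /dif /sym !fctE /= opprD; ring.
Qed.

Variables (mu : F) (phi : F -> F).
Local Notation ch := (chi phi).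
Local Notation ct := (chit r1 r2 phi).
Local Notation H1 := (opH1 rho1 rho2 r1 r2 mu phi).
Local Notation FF := (opF r1 r2 phi).
Local Notation BB := (opB rho1 rho2 r1 r2 phi).

(** [L0] and [L1], applied to a pair of functions. *)
Definition rowH (u v : F -> F) (x : F) : F := a x * u x + v x.
Definition rowF (u v : F -> F) (x : F) : F := u x / ch x + v x / ct x.

Lemma opF_row f x : FF f x = rowF (dif f) (sym f) x.
Proof.
rewrite /opF /rowF /opM /opT /opR /opI /dif /sym !fctE /= opprD refl1K; ring.
Qed.

Lemma opB_row g x :
  BB g x = rowH (dif (fun y => ct y * g y)) (sym (fun y => a y * ch y * g y)) x.
Proof.
rewrite /opB /rowH /opM /opT /opR /opI /dif /sym !fctE /= opprD refl1K; ring.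
Qed.

Lemma chi_opp x : ch (- x) = - ch x.
Proof. by rewrite /chi opprK opprB. Qed.

Lemma chit_refl1 x : ct (- x - 1) = ct x.
Proof. exact: sym_refl1. Qed.

(** * Consequences of the eigenvalue equation for the seed *)

Hypotheses (phiK : member K phi) (eigen_phi : H phi =[K] (fun x => mu * phi x)).
Hypotheses (chi_neq0 : ~ (ch =[K] (fun=> 0)))
  (chit_neq0 : ~ (ct =[K] (fun=> 0))).

Lemma chi_neq0_near : \forall x \near generic K, ch x != 0.
Proof.
apply: near_neq0 chi_neq0.
exact: memberD phiK (memberN (member_opp phiK)).
Qed.

Lemma chit_neq0_near : \forall x \near generic K, ct x != 0.
Proof.
apply: near_neq0 chit_neq0.
have refl1_member f : member K f -> member K (fun x => f (- x - 1)).
  move=> /member_opp /member_add1; congr member; apply/funext => x /=.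
  by rewrite opprD.
apply: memberD; apply: memberM => //.
- exact/refl1_member/beta_member.
- exact: beta_member.
- exact: refl1_member.
Qed.

(** The eigenvalue equation for the seed, since [dif phi = - chi] and
    [sym phi = chit]. *)
Lemma chit_seed : ct =[K] (fun x => a x * ch x + (mu - b) * phi x).
Proof.
apply: filterS2 eigen_phi (opH_dif_sym phi) => x -> eig.
by rewrite mulrBl eig /dif /sym /chi /chit; ring.
Qed.

Lemma chit_sub_opp :
  (fun x => ct x - ct (- x)) =[K]
  (fun x => (a x + a (- x) + (mu - b)) * ch x).
Proof.
apply: filterS2 chit_seed (near_opp chit_seed) => x -> ->.
by rewrite chi_opp /chi; ring.
Qed.

(** The seed equations at [x] and [-x-1] share the value [chit x]; weighted by
    [beta (-x-1)] and [beta x], which add up to [- b], they combine the two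
    values of [phi] into [chit x] again. *)
Lemma sym_achi : sym (fun x => a x * ch x) =[K] (fun x => - mu * ct x).
Proof.
near=> x.
have bE : be x + be (- x - 1) = - b.
  by apply: beta_add_refl1; near: x; exact: near_denom_neq0.
have e : ct x = a x * ch x + (mu - b) * phi x by near: x; exact: chit_seed.
have e' : ct x = a (- x - 1) * ch (- x - 1) + (mu - b) * phi (- x - 1).
  by rewrite -chit_refl1; near: x; exact: near_refl1 chit_seed.
rewrite /sym.
have -> : a x * ch x = ct x - (mu - b) * phi x by rewrite e addrK.
have -> : a (- x - 1) * ch (- x - 1) = ct x - (mu - b) * phi (- x - 1).
  by rewrite e' addrK.
transitivity ((be x + be (- x - 1)) * ct x - (mu - b) * ct x).
  by rewrite [in X in _ = _ - X]/chit; ring.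
by rewrite bE; ring.
Unshelve. all: by end_near. Qed.

(** * Exchanging rows and columns *)

(** The first component of [C1 L1 = C0 L0 - (mu - b)]: [u / chi] is even. *)
Lemma dif_chit_rowF u v : (forall x, u (- x) = - u x) ->
  dif (fun x => ct x * rowF u v x) =[K]
  (fun x => dif (rowH u v) x - (mu - b) * u x).
Proof.
move=> u_odd; near=> x.
have ch0 : ch x != 0 by near: x; exact: chi_neq0_near.
have ct0 : ct x != 0 by near: x; exact: chit_neq0_near.
have ct0' : ct (- x) != 0 by near: x; exact: near_opp chit_neq0_near.
have e : ct x - ct (- x) = (a x + a (- x) + (mu - b)) * ch x.
  by near: x; exact: chit_sub_opp.
rewrite /dif /rowF /rowH chi_opp u_odd.
transitivity (v (- x) - v x - (ct x - ct (- x)) * (u x / ch x)).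
  by field; rewrite ch0 ct0 ct0'.
by rewrite e; field.
Unshelve. all: by end_near. Qed.

(** The second component of [C1 L1 = C0 L0 - (mu - b)]: [v / chit] is
    invariant under [x |-> -x-1]. *)
Lemma sym_achi_rowF u v : (forall x, v (- x - 1) = v x) ->
  sym (fun x => a x * ch x * rowF u v x) =[K]
  (fun x => sym (rowH u v) x - (mu - b) * v x).
Proof.
move=> v_inv; near=> x.
have bE : be x + be (- x - 1) = - b.
  by apply: beta_add_refl1; near: x; exact: near_denom_neq0.
have ch0 : ch x != 0 by near: x; exact: chi_neq0_near.
have ch0' : ch (- x - 1) != 0 by near: x; exact: near_refl1 chi_neq0_near.
have ct0 : ct x != 0 by near: x; exact: chit_neq0_near.
have e : sym (fun y => a y * ch y) x = - mu * ct x.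
  by near: x; exact: sym_achi.
transitivity (be (- x - 1) * (a x * u x)
  + be x * (a (- x - 1) * u (- x - 1))
  + sym (fun y => a y * ch y) x * (v x / ct x)).
  by rewrite /sym /rowF v_inv chit_refl1; field; rewrite ch0 ch0' ct0.
rewrite e /sym /rowH v_inv.
have -> : b = - (be x + be (- x - 1)) by rewrite bE opprK.
by field.
Unshelve. all: by end_near. Qed.

(** [C1 F = C0 (H - mu)], componentwise. *)
Lemma dif_chit_opF f :
  dif (fun x => ct x * FF f x) =[K] (fun x => dif (H f) x - mu * dif f x).
Proof.
have FE := dif_chit_rowF (sym f) (@dif_odd f).
apply: filterS2 FE (dif_ext (opH_dif_sym f)) => x.
under eq_fun do rewrite -opF_row.
by move=> -> ->; rewrite difDZ /rowH; ring.
Qed.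

Lemma sym_achi_opF f :
  sym (fun x => a x * ch x * FF f x) =[K]
  (fun x => sym (H f) x - mu * sym f x).
Proof.
have FE := sym_achi_rowF (dif f) (sym_refl1 f).
apply: filterS2 FE (sym_ext (opH_dif_sym f)) => x.
under eq_fun do rewrite -opF_row.
by move=> -> ->; rewrite symDZ /rowH; ring.
Qed.

(** [H1 - mu = L1 C1]: the coefficients of [R] and [TR] match as they stand, and
    the multiplication parts match by [chit_sub_opp] and [sym_achi]. *)
Lemma opH1_row g :
  H1 g =[K] (fun x => rowF (dif (fun y => ct y * g y))
                           (sym (fun y => a y * ch y * g y)) x + mu * g x).
Proof.
near=> x.
have x0 : x != 0 by near: x; exact: generic_neq.
have ch0 : ch x != 0 by near: x; exact: chi_neq0_near.
have ct0 : ct x != 0 by near: x; exact: chit_neq0_near.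
have e1 : ct x - ct (- x) = (a x + a (- x) + (mu - b)) * ch x.
  by near: x; exact: chit_sub_opp.
have e2 : sym (fun y => a y * ch y) x = - mu * ct x.
  by near: x; exact: sym_achi.
have aE : alpha_cst rho1 rho2 = a x + a (- x).
  by rewrite /alpha /alpha_cst; field.
(* Both constants are rewritten as quotients of values of [chi] and [chit],
   after which the two sides are equal as rational expressions. *)
have cE : mu + alpha_cst rho1 rho2 - b = (ct x - ct (- x)) / ch x.
  by rewrite aE e1; field.
have muE : mu = - sym (fun y => a y * ch y) x / ct x by rewrite e2; field.
rewrite /opH1 /opC /opM /opT /opR /opI !fctE /= cE opprD.
rewrite [in RHS]muE /rowF /dif /sym.
by field; rewrite ch0 ct0.
Unshelve. all: by end_near. Qed.

(** [C1 (H1 - b) = C0 B], componentwise. *)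
Lemma dif_chit_opH1 g :
  dif (fun x => ct x * H1 g x) =[K]
  (fun x => dif (BB g) x + b * dif (fun y => ct y * g y) x).
Proof.
set u := dif (fun y => ct y * g y); set v := sym (fun y => a y * ch y * g y).
have HE : (fun x => ct x * H1 g x) =[K]
    (fun x => ct x * rowF u v x + mu * (ct x * g x)).
  by apply: filterS (opH1_row g) => x ->; rewrite -/u -/v; ring.
have BE : BB g = rowH u v by apply/funext => x; exact: opB_row.
have uE := dif_chit_rowF v (@dif_odd (fun y => ct y * g y)).
apply: filterS2 (dif_ext HE) uE => x -> /= uE.
by rewrite difDZ uE BE -/u; ring.
Qed.

Lemma sym_achi_opH1 g :
  sym (fun x => a x * ch x * H1 g x) =[K]
  (fun x => sym (BB g) x + b * sym (fun y => a y * ch y * g y) x).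
Proof.
set u := dif (fun y => ct y * g y); set v := sym (fun y => a y * ch y * g y).
have HE : (fun x => a x * ch x * H1 g x) =[K]
    (fun x => a x * ch x * rowF u v x + mu * (a x * ch x * g x)).
  by apply: filterS (opH1_row g) => x ->; rewrite -/u -/v; ring.
have BE : BB g = rowH u v by apply/funext => x; exact: opB_row.
have vE := sym_achi_rowF u (sym_refl1 (fun y => a y * ch y * g y)).
apply: filterS2 (sym_ext HE) vE => x -> /= vE.
by rewrite symDZ vE BE -/v; ring.
Qed.

(** * Intertwining and factorization *)

Lemma opF_seed : FF phi =[K] (fun=> 0).
Proof.
apply: filterS2 chi_neq0_near chit_neq0_near => x ch0 ct0.
rewrite opF_row /rowF -[dif phi x]opprB mulNr.
by rewrite -/(ch x) -[sym phi x]/(ct x) !divff ?addNr.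
Qed.

Lemma opF_opH f : FF (H f) =[K] H1 (FF f).
Proof.
apply: filterS3 (opH1_row (FF f)) (dif_chit_opF f) (sym_achi_opF f).
by move=> x -> Dx Sx; rewrite /rowF Dx Sx !opF_row /rowF; ring.
Qed.

Lemma opH_opB g : H (BB g) =[K] BB (H1 g).
Proof.
apply: filterS3 (opH_dif_sym (BB g)) (dif_chit_opH1 g) (sym_achi_opH1 g).
by move=> x -> Dx Sx; rewrite 2!opB_row /rowH Dx Sx; ring.
Qed.

Lemma opB_opF f : BB (FF f) =[K] (H - opC mu) ((H - opC b) f).
Proof.
have HB (h : F -> F) x : H (h - opC b f) x = H h x - b * H f x.
  by rewrite /opH /opC /opM /opT /opR /opI !fctE /=; ring.
apply: filterS3 (dif_chit_opF f) (sym_achi_opF f)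
  (filterI (opH_dif_sym f) (opH_dif_sym (H f))) => x Dx Sx [Hx HHx].
transitivity (H (H f - opC b f) x - mu * (H f x - b * f x)) => //.
by rewrite opB_row /rowH Dx Sx HB HHx Hx; ring.
Qed.

Lemma opF_opB g : FF (BB g) =[K] (H1 - opC mu) ((H1 - opC b) g).
Proof.
have H1B (h : F -> F) x : H1 (h - opC b g) x = H1 h x - b * H1 g x.
  by rewrite /opH1 /opC /opM /opT /opR /opI !fctE /=; ring.
apply: filterS3 (dif_chit_opH1 g) (sym_achi_opH1 g)
  (filterI (opH1_row g) (opH1_row (H1 g))) => x Dx Sx [Hx HHx].
transitivity (H1 (H1 g - opC b g) x - mu * (H1 g x - b * g x)) => //.
by rewrite opF_row H1B HHx /rowF Dx Sx Hx /rowF; ring.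
Qed.

End Operators.

Theorem theorem2p5 (F : numFieldType) (K : functionField F)
  (rho1 rho2 r1 r2 : F)
  (rho1_real : rho1 \is Num.real) (rho2_real : rho2 \is Num.real)
  (r1_real : r1 \is Num.real) (r2_real : r2 \is Num.real)
  (mu : F) (phi : F -> F) (phiK : member K phi)
  (H := opH rho1 rho2 r1 r2)
  (eigen_phi : H phi =[K] (fun x => mu * phi x))
  (chi_neq0 : ~ (chi phi =[K] (fun=> 0)))
  (chit_neq0 : ~ (chit r1 r2 phi =[K] (fun=> 0)))
  (H1 := opH1 rho1 rho2 r1 r2 mu phi)
  (Fphi := opF r1 r2 phi)
  (Bphi := opB rho1 rho2 r1 r2 phi)
  (b := beta_cst r1 r2) :
  [/\ Fphi phi =[K] (fun=> 0),
      Fphi \o H =op[K] H1 \o Fphi,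
      H \o Bphi =op[K] Bphi \o H1,
      Bphi \o Fphi =op[K] (H - opC mu) \o (H - opC b)
    & Fphi \o Bphi =op[K] (H1 - opC mu) \o (H1 - opC b)].
Proof.
by split=> [|f _|f _|f _|f _];
  [apply: opF_seed|apply: opF_opH|apply: opH_opB|apply: opB_opF|apply: opF_opB].
Qed.
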